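(* Let $C \subset \mathbb{S}^{47}$ be a spherical $11$-design whose set of inner products $I(C)=\{\langle x,y\rangle : x,y\in C,\ x\neq y\}$ satisfies $I(C) \subset [-1,1)\setminus F'$, where $F'=\left(-\tfrac12,-\tfrac13\right)\cup\left(\tfrac13,\tfrac12\right)$. Then $|C| \geq 52\,416\,000$. If equality holds, then $C$ is distance invariant and its distance distribution is \[ A_{-1}=1,\quad A_{1/2}=A_{-1/2}=36\,848,\quad A_{1/3}=A_{-1/3}=1\,678\,887,\quad A_{1/6}=A_{-1/6}=12\,608\,784,\quad A_0=23\,766\,960 \] (with $A_t=0$ for all other $t$).
   Context: A spherical $\tau$-design is a finite set $C\subset\mathbb{S}^{n-1}$ such that $\int_{\mathbb{S}^{n-1}} p\, d\sigma_n = \frac{1}{|C|}\sum_{x\in C} p(x)$ for every polynomial $p$ in $n$ variables of degree at most $\tau$, where $\sigma_n$ is the normalized surface measure. For $x\in C$ and $t\in[-1,1)$, $A_t(x)=|\{y\in C: \langle x,y\rangle = t\}|$; $C$ is distance invariant if $A_t(x)$ does not depend on $x\in C$ for every $t$, and then one writes $A_t$. *)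

(* Defs.v *)
From HB Require Import structures.
From mathcomp Require Import all_boot all_order all_algebra.
From mathcomp Require Import all_classical all_reals all_analysis.
From mathcomp Require mpoly.

Set Implicit Arguments.
Unset Strict Implicit.
Unset Printing Implicit Defensive.
Import Order.TTheory GRing.Theory Num.Theory.
Import numFieldNormedType.Exports.
Local Open Scope ring_scope.

Section SphericalDesigns.
Variable R : realType.

Definition dotv (n : nat) (x y : 'rV[R]_n) : R := \sum_(i < n) x 0 i * y 0 i.

Definition on_sphere (n : nat) (x : 'rV[R]_n) : Prop := dotv x x = 1.

(* Iterated Lebesgue integral over R^n:
   iter_int n f = \int dx_{n-1} ... \int dx_0 f(x_0, ..., x_{n-1}),
   where a point is encoded as a function nat -> R (coordinates >= n unused).
   By Fubini/Tonelli this is the Lebesgue integral over R^n for integrable f. *)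
Fixpoint iter_int (n : nat) (f : (nat -> R) -> R) : R :=
  match n with
  | 0 => f (fun _ => 0)
  | k.+1 => \int[@lebesgue_measure R]_(t in [set: R])
              iter_int k (fun g => f (fun j => if j == k then t else g j))
  end.

Definition vec_of (n : nat) (g : nat -> R) : 'rV[R]_n := \row_(i < n) g i.

(* Normalized integral over the sphere S^{n-1} with respect to the normalized
   surface measure sigma_n, defined through the cone (polar) construction:
     \int_{S^{n-1}} h dsigma_n = (1/vol(B^n)) \int_{B^n} h(x/|x|) dx,
   B^n the closed unit ball (the point x = 0 is a null set). *)
Definition sphere_avg (n : nat) (h : 'rV[R]_n -> R) : R :=
  iter_int n (fun g => let x := vec_of n g in
                       if dotv x x <= 1 then h ((Num.sqrt (dotv x x))^-1 *: x)
                       else 0)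
  / iter_int n (fun g => let x := vec_of n g in
                         if dotv x x <= 1 then 1 else 0).

Definition peval (n : nat) (p : mpoly.mpoly n R) (x : 'rV[R]_n) : R :=
  mpoly.meval (fun i => x 0 i) p.

Definition spherical_design (n tau : nat) (C : seq 'rV[R]_n) : Prop :=
  uniq C /\ (forall x, x \in C -> on_sphere x) /\
  forall p : mpoly.mpoly n R,
    all (fun m => (mpoly.mdeg m <= tau)%N) (mpoly.msupp p) ->
    sphere_avg (peval p) = (size C)%:R^-1 * \sum_(x <- C) peval p x.

Definition A_count (n : nat) (C : seq 'rV[R]_n) (t : R) (x : 'rV[R]_n) : nat :=
  count (fun y => dotv x y == t) C.

Definition distance_invariant (n : nat) (C : seq 'rV[R]_n) : Prop :=
  forall t, -1 <= t < 1 ->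
    forall x y, x \in C -> y \in C -> A_count C t x = A_count C t y.

Definition in_F' (t : R) : Prop :=
  (- (1/2) < t < - (1/3)) \/ (1/3 < t < 1/2).

Definition theorem7_distribution (t : R) : nat :=
  if t == -1 then 1%N
  else if (t == 1/2) || (t == - (1/2)) then 36848%N
  else if (t == 1/3) || (t == - (1/3)) then 1678887%N
  else if (t == 1/6) || (t == - (1/6)) then 12608784%N
  else if t == 0 then 23766960%N
  else 0%N.

End SphericalDesigns.

(* Main.v *)
(* Linear programming bound. The sphere average is rotation invariant because, by
   Fubini and translation invariance of Lebesgue measure, the iterated integral is
   invariant under shears, and a plane rotation is a product of three shears. Hence
   the k-th moment of a design in a direction a depends only on |a|; comparing the
   coefficients of t^2 in the moment in direction e_0 + t e_i gives a recursion for
   these moments, so that the sum over y in C of p(<x,y>) is known for every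
   polynomial p of degree at most 11. Take
     f(t) = (t + 1) (t^2 - 1/4) (t^2 - 1/9) (t^2 - 1/36)^2 t^2,
   which is nonnegative on the allowed inner products: f(1) is then at most |C|
   times the mean of f. In the equality case all inner products are roots of f and
   the Lagrange polynomials at these eight roots yield the distance distribution. *)
Require Import Defs.
From HB Require Import structures.
From mathcomp Require Import all_boot all_order all_algebra.
From mathcomp Require Import all_classical all_reals all_analysis.
From mathcomp Require Import measurable_realfun ring lra.
From mathcomp Require mpoly.
Set Implicit Arguments.
Unset Strict Implicit.
Unset Printing Implicit Defensive.
Import Order.TTheory GRing.Theory Num.Theory.
Import numFieldNormedType.Exports.
Local Open Scope ring_scope.

(** * Iterated integrals *)

Section IteratedIntegral.
Variable R : realType.
Local Notation mu := (@lebesgue_measure R).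
Implicit Types (F : (nat -> R) -> R) (g : nat -> R) (P : pred nat).

Definition upd g (i : nat) (t : R) : nat -> R := fun j => if j == i then t else g j.

Lemma updC g i j s t : i != j -> upd (upd g i s) j t = upd (upd g j t) i s.
Proof.
move=> ij; apply/funext => k; rewrite /upd.
by case: (eqVneq k j) => // ->; rewrite eq_sym (negbTE ij).
Qed.

Definition coord_int (i : nat) F : (nat -> R) -> R :=
  fun g => \int[mu]_(t in [set: R]) F (upd g i t).

(** Unlike in [iter_int], the base point stays a free argument: each integration is an operator on
    functions of all coordinates, and such operators can be permuted. *)
Fixpoint coords_int (k : nat) F : (nat -> R) -> R :=
  if k is m.+1 then coord_int m (coords_int m F) else F.

(** The first [m] integrations overwrite only coordinates below [m], so a coordinate [k >= m] may be
    set before or after them. This is what relates [iter_int] to [coords_int]. *)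
Lemma coords_int_upd m k t F g : (m <= k)%N ->
  coords_int m (fun h => F (upd h k t)) g = coords_int m F (upd g k t).
Proof.
elim: m g => // m IH g mk; rewrite /= /coord_int.
by apply: eq_Rintegral => s _; rewrite IH ?(ltnW mk)// updC// ltn_eqF.
Qed.

Lemma iter_intE n F : iter_int n F = coords_int n F (fun=> 0).
Proof.
elim: n F => // n IH F; rewrite /= /coord_int; apply: eq_Rintegral => t _.
by rewrite IH -coords_int_upd.
Qed.

(* Measurability for the product sigma-algebra on [nat -> R], tested on all
   families of measurable coordinates. *)
Definition cmeasurable F := forall d (T : measurableType d) (h : T -> nat -> R),
  (forall j, measurable_fun [set: T] (fun x => h x j)) ->
  measurable_fun [set: T] (fun x => F (h x)).

(** A class of integrands stable under integration in one coordinate, on which Tonelli applies and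
    integrals are finite. [P] marks the coordinates still to be integrated; in these the support is
    bounded. *)
Record nice P F : Prop := Nice {
  nice_measurable : cmeasurable F;
  nice_ge0 : forall g, 0 <= F g;
  nice_le : exists M, forall g, F g <= M;
  nice_supp : exists B, forall g i, P i -> F g != 0 -> `|g i| <= B }.

Lemma sub_nice P (Q : pred nat) F : (forall i, Q i -> P i) -> nice P F -> nice Q F.
Proof.
move=> QP [mF F0 bF [B sF]]; split=> //; exists B => g i /QP; exact: sF.
Qed.

Lemma measurable_upd d (T : measurableType d) (h : T -> nat -> R) (f : T -> R) i :
  (forall j, measurable_fun [set: T] (fun x => h x j)) ->
  measurable_fun [set: T] f ->
  forall j, measurable_fun [set: T] (fun x => upd (h x) i (f x) j).
Proof. by move=> mh mf j; rewrite /upd; case: eqP. Qed.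

Lemma measurable_EFin_comp d (T : measurableType d) (f : T -> R) :
  measurable_fun [set: T] f -> measurable_fun [set: T] (fun x => (f x)%:E).
Proof. by move=> mf; exact/measurable_EFinP. Qed.

Lemma measurable_slice F g i : cmeasurable F ->
  measurable_fun [set: measurableTypeR R] (fun t => F (upd g i t)).
Proof. by move=> mF; apply: mF; exact: measurable_upd. Qed.

(** Each slice lies below [M] times the indicator of [[-|B|, |B|]]. The resulting bound is uniform
    in [g], so the integrated function is bounded again. *)
Lemma coord_int_bound P F i : nice P F -> P i -> exists K : R,
  forall g, (\int[mu]_(t in [set: R]) (F (upd g i t))%:E <= K%:E)%E.
Proof.
move=> [mF F0 [M FM] [B sF]] Pi.
pose D := `[- `|B|, `|B|]%classic : set R.
have mD : measurable (D : set (measurableTypeR R)) by exact: measurable_itv.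
exists (M * (`|B| + `|B|)) => g.
have M0 : 0 <= M by apply: le_trans (FM g).
apply: (@le_trans _ _ (\int[mu]_(t in [set: R]) (M * \1_D t)%:E)%E).
  apply: ge0_le_integral => //.
  - by move=> t _; rewrite lee_fin.
  - by apply: measurable_EFin_comp; exact: measurable_slice.
  - by apply: measurable_EFin_comp; apply: measurable_funM => //; exact: measurable_indic.
  - move=> t _; rewrite lee_fin indicE.
    have [->|Fn0] := eqVneq (F (upd g i t)) 0; first by rewrite mulr_ge0.
    suff -> : t \in D by rewrite mulr1.
    rewrite inE /D /= in_itv /= -ler_norml.
    have := sF _ _ Pi Fn0; rewrite /upd eqxx => /le_trans; apply; exact: ler_norm.
under eq_integral => t _ do rewrite EFinM.
rewrite ge0_integralZl//; last first.
  by apply: measurable_EFin_comp; exact: measurable_indic.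
rewrite integral_indic//= setIT /D lebesgue_measure_itv /=.
case: ifPn => _; first by rewrite -EFinD -EFinM opprK.
by rewrite mule0 lee_fin mulr_ge0// addr_ge0.
Qed.

(** A real-valued integral sends infinite values to [0]; the finite bound makes the passage to
    extended reals faithful. *)
Lemma coord_int_EFin P F i g : nice P F -> P i ->
  (coord_int i F g)%:E = (\int[mu]_(t in [set: R]) (F (upd g i t))%:E)%E.
Proof.
move=> nF Pi; have [K FK] := coord_int_bound nF Pi.
rewrite /coord_int /Rintegral fineK// ge0_fin_numE.
  by apply: le_lt_trans (FK g) _; rewrite ltry.
by apply: integral_ge0 => t _; rewrite lee_fin; exact: nice_ge0 nF _.
Qed.

(** Measurability is the first half of Tonelli. Coordinate [i] leaves [P] because the integral no
    longer depends on it. *)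
Lemma coord_int_nice P F i : nice P F -> P i -> nice (fun j => P j && (j != i)) (coord_int i F).
Proof.
move=> nF Pi; have [K FK] := coord_int_bound nF Pi; case: (nF) => mF F0 bF [B sF].
split.
- move=> d T h mh; apply/measurable_EFinP.
  rewrite (_ : _ \o _ = fubini_F mu (fun z : T * R => (F (upd (h z.1) i z.2))%:E)).
    apply: measurable_fun_fubini_tonelli_F => [|z]; last by rewrite lee_fin.
    apply: measurable_EFin_comp; apply: mF; apply: measurable_upd => [j|];
      last exact: measurable_snd.
    exact: (measurableT_comp (mh j) measurable_fst).
  by apply/funext => x; rewrite /= (coord_int_EFin _ nF Pi).
- by move=> g; rewrite -lee_fin (coord_int_EFin _ nF Pi);
    apply: integral_ge0 => t _; rewrite lee_fin.
- by exists K => g; rewrite -lee_fin (coord_int_EFin _ nF Pi).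
- exists B => g j /andP[Pj ji]; apply: contra_neqT => gB.
  have -> : coord_int i F g = \int[mu]_(t in [set: R]) (cst 0) t.
    apply: eq_Rintegral => t _; apply/eqP; apply: contraNT gB => Fn0.
    by have := sF _ _ Pj Fn0; rewrite /upd (negbTE ji).
  by rewrite /Rintegral integral0_eq.
Qed.

Lemma coord_intC P F i j : nice P F -> P i -> P j -> i != j ->
  coord_int i (coord_int j F) = coord_int j (coord_int i F).
Proof.
move=> nF Pi Pj ij; apply/funext => g; apply: EFin_inj.
have nj := coord_int_nice nF Pj; have ni := coord_int_nice nF Pi.
have Pij : P i && (i != j) by rewrite Pi.
have Pji : P j && (j != i) by rewrite Pj eq_sym.
rewrite (coord_int_EFin _ nj Pij) (coord_int_EFin _ ni Pji).
under eq_integral => t _ do rewrite (coord_int_EFin _ nF Pj).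
under [RHS]eq_integral => t _ do rewrite (coord_int_EFin _ nF Pi).
rewrite (@fubini_tonelli _ _ _ _ _ mu mu (fun z : R * R => (F (upd (upd g i z.1) j z.2))%:E)) /=.
- by apply: eq_integral => s _; apply: eq_integral => t _; rewrite updC.
- apply: measurable_EFin_comp; apply: (nice_measurable nF);
    apply: measurable_upd; last exact: measurable_snd.
  by apply: measurable_upd => //; exact: measurable_fst.
- by move=> z; rewrite lee_fin (nice_ge0 nF).
Qed.

Lemma coords_int_nice m n F : (m <= n)%N ->
  nice [pred i | (i < n)%N] F -> nice [pred i | (m <= i < n)%N] (coords_int m F).
Proof.
elim: m => [|m IH] mn nF.
  by apply: sub_nice nF => i /=.
apply: (sub_nice (P := fun j => (m <= j < n)%N && (j != m))).
  by move=> i /= /andP[mi ->]; rewrite gtn_eqF// ltnW.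
by apply: (@coord_int_nice [pred i | (m <= i < n)%N]);
  [apply: IH => //; exact: ltnW | rewrite /= leqnn].
Qed.

Lemma coord_int_coords_intC m i n F : (m <= i < n)%N ->
  nice [pred j | (j < n)%N] F ->
  coord_int i (coords_int m F) = coords_int m (coord_int i F).
Proof.
move=> + nF; elim: m => // m IH /andP[mi ilt] /=.
rewrite -IH ?(ltnW mi)//; apply: (@coord_intC [pred j | (m <= j < n)%N]).
- by apply: coords_int_nice => //; exact: ltnW (ltn_trans mi ilt).
- by rewrite /= (ltnW mi).
- by rewrite /= leqnn (ltn_trans mi ilt).
- by rewrite gtn_eqF.
Qed.

(* Fubini moves the integration in the [i]-th coordinate to the innermost place. *)
Lemma coords_int_eq_coord n i F G : (i < n)%N ->
  nice [pred j | (j < n)%N] F -> nice [pred j | (j < n)%N] G ->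
  coord_int i F = coord_int i G -> coords_int n F = coords_int n G.
Proof.
move=> ilt nF nG FG.
have step : coords_int i.+1 F = coords_int i.+1 G.
  by rewrite /= !(@coord_int_coords_intC i i n) ?leqnn// FG.
suff H k : coords_int (i.+1 + k) F = coords_int (i.+1 + k) G.
  by rewrite -(subnKC ilt) H.
elim: k => [|k IH]; first by rewrite addn0.
by rewrite addnS -[LHS]/(coord_int _ (coords_int (i.+1 + k) F)) IH.
Qed.

(** * Translation invariance of Lebesgue measure, and invariance under shears *)

Section Shift.
Variable c : R.
Let shift_c (t : measurableTypeR R) : measurableTypeR R := t + c.

Let measurable_shift : measurable_fun [set: measurableTypeR R] shift_c.
Proof. exact: measurable_funD. Qed.

HB.instance Definition _ := isMeasurableFun.Build _ _ _ _ shift_c measurable_shift.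

(** Lebesgue measure is determined by its values on half-open intervals, and the preimage of such an
    interval has the same length. *)
Lemma lebesgue_measure_shift (A : set R) : measurable A ->
  pushforward mu shift_c A = mu A.
Proof.
move=> mA; apply/esym/lebesgue_measure_unique => //= _ [[a b]] _ <-.
rewrite /pushforward (_ : (_ @^-1` _)%classic = `]a - c, b - c]%classic); last first.
  by apply/seteqP; split=> t /=; rewrite !in_itv /= ltrBlDr lerBrDr.
by rewrite /= !lebesgue_measure_itv /= !lte_fin ltrD2r -!EFinD opprB addrA addrNK.
Qed.

Lemma ge0_integral_shift (f : R -> R) :
  measurable_fun [set: measurableTypeR R] f -> (forall t, 0 <= f t) ->
  (\int[mu]_(t in [set: R]) (f (t + c))%:E = \int[mu]_(t in [set: R]) (f t)%:E)%E.
Proof.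
move=> mf f0.
transitivity (\int[pushforward mu shift_c]_(t in [set: R]) (f t)%:E)%E.
  rewrite ge0_integral_pushforward//.
    exact: measurable_EFin_comp.
  by move=> t _; rewrite lee_fin.
by apply: eq_measure_integral => A mA _; exact: lebesgue_measure_shift.
Qed.

End Shift.

Definition shear (i j : nat) (c : R) g := upd g i (g i + c * g j).

Lemma shear_nice n i j c F : (i < n)%N -> (j < n)%N -> i != j ->
  nice [pred k | (k < n)%N] F -> nice [pred k | (k < n)%N] (F \o shear i j c).
Proof.
move=> ilt jlt ij [mF F0 [M FM] [B sF]]; split.
- move=> d T h mh; apply: mF; apply: measurable_upd => //.
  by apply: measurable_funD => //; exact: measurable_funM.
- by move=> g; exact: F0.
- by exists M => g; exact: FM.
(* The original coordinate is [(g i + c * g j) - c * g j], a difference of terms bounded by [B] and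
   [|c| * B]. *)
- exists (B + `|c| * B) => g k kn Fn0.
  have gj : `|g j| <= B.
    by have := sF _ _ jlt Fn0; rewrite /shear /upd eq_sym (negbTE ij).
  have cB : 0 <= `|c| * B by rewrite mulr_ge0// (le_trans _ gj).
  have [->|ki] := eqVneq k i; last first.
    have := sF _ _ kn Fn0; rewrite /shear /upd (negbTE ki) => /le_trans; apply.
    by rewrite lerDl.
  have := sF _ _ ilt Fn0; rewrite /shear /upd eqxx => gi.
  rewrite -[g i](addrK (c * g j)); apply: le_trans (ler_normB _ _) _.
  by rewrite lerD// normrM ler_wpM2l.
Qed.

(** With the other coordinates fixed, a shear is a translation of coordinate [i] by the constant
    [c * g j]; it suffices to compare the integrals in that coordinate. *)
Lemma coords_int_shear n i j c F : (i < n)%N -> (j < n)%N -> i != j ->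
  nice [pred k | (k < n)%N] F ->
  coords_int n (F \o shear i j c) = coords_int n F.
Proof.
move=> ilt jlt ij nF; have nS := shear_nice c ilt jlt ij nF.
apply: (coords_int_eq_coord ilt) => //.
apply/funext => g; apply: EFin_inj.
rewrite (coord_int_EFin _ nS)// (coord_int_EFin _ nF)//.
rewrite -(@ge0_integral_shift (c * g j) (fun t => F (upd g i t))) //.
- apply: eq_integral => t _; congr (F _)%:E; apply/funext => k.
  by rewrite /= /shear /upd eqxx [j == i]eq_sym (negbTE ij); case: eqP.
- by apply: measurable_slice; exact: nice_measurable nF.
- by move=> t; exact: nice_ge0 nF _.
Qed.

(** Each integral is restricted to [[0, a]] in turn. This serves to bound the volume of the ball
    from below by that of a cube inside it. *)
Lemma coords_int_ge n F (a : R) : 0 <= a ->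
  nice [pred k | (k < n)%N] F ->
  (forall g, (forall k, (k < n)%N -> 0 <= g k <= a) -> 1 <= F g) ->
  forall m g, (m <= n)%N -> (forall k, (m <= k < n)%N -> 0 <= g k <= a) ->
  a ^+ m <= coords_int m F g.
Proof.
move=> a0 nF F1; elim=> [|m IH] g mn ga /=.
  by apply: F1 => k kn; exact: ga.
have nm := coords_int_nice (ltnW mn) nF.
rewrite -lee_fin (coord_int_EFin _ nm) /= ?leqnn//.
pose D := `[0, a]%classic : set R.
have mD : measurable (D : set (measurableTypeR R)) by exact: measurable_itv.
have mc : measurable_fun [set: measurableTypeR R] (fun t => (coords_int m F (upd g m t))%:E).
  by apply: measurable_EFin_comp; apply: measurable_slice; exact: nice_measurable nm.
apply: (@le_trans _ _ (\int[mu]_(t in D) (a ^+ m)%:E)%E).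
  rewrite integral_cst//= /D lebesgue_measure_itv /= exprSr EFinM.
  case: ifPn => [_|]; first by rewrite oppr0 adde0.
  by rewrite lte_fin -leNgt => a0'; rewrite (le_anti (introT andP (conj a0' a0))).
apply: (@le_trans _ _ (\int[mu]_(t in D) (coords_int m F (upd g m t))%:E)%E).
  apply: ge0_le_integral => //.
  - by move=> t _; rewrite lee_fin exprn_ge0.
  - exact: measurable_funS mc.
  - move=> t; rewrite /D /= in_itv /= => ta; rewrite lee_fin; apply: IH; first exact: ltnW.
    move=> k /andP[mk kn]; rewrite /upd; case: eqP => // /eqP km.
    by apply: ga; rewrite kn andbT ltn_neqAle eq_sym km.
apply: ge0_subset_integral => //.
by move=> t _; rewrite lee_fin (nice_ge0 nm).
Qed.

End IteratedIntegral.

(** * Rotation invariance of the sphere average *)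

Section PowerOfLinearForm.
Import -(notations) mpoly.

Lemma msize_exp_le (R : realType) n (p : mpoly n R) k :
  (msize p <= 2)%N -> (msize (p ^+ k) <= k.+1)%N.
Proof.
move=> p2; elim: k => [|k IH]; first by rewrite expr0 msize1.
have [->|p0] := eqVneq p 0; first by rewrite exprS mul0r msize0.
have pk0 : p ^+ k != 0 by rewrite expf_neq0.
rewrite exprS msizeM ?p0 ?pk0//.
by rewrite -subn1 leq_subLR -[(1 + _)%N]/(2 + k.+1)%N leq_add.
Qed.

(** The constant [M] will be chosen so large that the polynomial is nonnegative on the unit ball, as
    [nice] demands of its cone function. *)
Definition lin_mpoly (R : realType) n (a : 'rV[R]_n) (k : nat) (M : R) : mpoly n R :=
  (\sum_(i < n) a 0 i *: mpolyX R (mnm1 i)) ^+ k + mpolyC n M.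

Lemma lin_mpoly_deg (R : realType) n (a : 'rV[R]_n) k (M : R) tau : (k <= tau)%N ->
  all (fun m => (mdeg m <= tau)%N) (msupp (lin_mpoly a k M)).
Proof.
move=> kt; apply/allP => m /msize_mdeg_lt mp; rewrite -ltnS; apply: leq_trans mp _.
apply: leq_trans (msizeD_le _ _) _; rewrite geq_max; apply/andP; split.
  apply: (@leq_trans k.+1) => //; apply: msize_exp_le.
  apply: leq_trans (msize_sum _ _ _) _; apply/bigmax_leqP => i _.
  by apply: leq_trans (msizeZ_le _ _) _; rewrite msizeX mdeg1.
by rewrite msizeC; case: (M != 0).
Qed.

Lemma peval_lin_mpoly (R : realType) n (a : 'rV[R]_n) k (M : R) y :
  peval (lin_mpoly a k M) y = dotv a y ^+ k + M.
Proof.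
rewrite /peval /lin_mpoly mevalD mevalC rmorphXn /=; congr (_ ^+ _ + _).
rewrite (big_morph _ (mevalD _) (meval0 _)).
by apply: eq_bigr => i _; rewrite mevalZ mevalXU.
Qed.

End PowerOfLinearForm.

Section Rotation.
Variables (R : realType) (n : nat).
Implicit Types (a x y : 'rV[R]_n) (g : nat -> R) (h : 'rV[R]_n -> R).

Lemma dotvZl (b : R) a y : dotv (b *: a) y = b * dotv a y.
Proof. by rewrite /dotv mulr_sumr; apply: eq_bigr => i _; rewrite mxE mulrA. Qed.

Lemma dotvC x y : dotv x y = dotv y x.
Proof. by apply: eq_bigr => i _; rewrite mulrC. Qed.

Lemma dotvDl a b y : dotv (a + b) y = dotv a y + dotv b y.
Proof. by rewrite /dotv -big_split; apply: eq_bigr => i _; rewrite mxE mulrDl. Qed.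

Lemma dotv_delta (i : 'I_n) y : dotv (delta_mx 0 i) y = y 0 i.
Proof.
rewrite /dotv (bigD1 i)//= mxE !eqxx mul1r big1 ?addr0// => j ji.
by rewrite mxE eqxx (negbTE ji) mul0r.
Qed.

Lemma dotv_ge0 x : 0 <= dotv x x.
Proof. by apply: sumr_ge0 => i _; rewrite -expr2 sqr_ge0. Qed.

Lemma dotv_self_ge x (i : 'I_n) : x 0 i ^+ 2 <= dotv x x.
Proof.
rewrite /dotv (bigD1 i)//= -expr2 lerDl.
by apply: sumr_ge0 => j _; rewrite -expr2 sqr_ge0.
Qed.

Definition rotv (i j : 'I_n) (c s : R) x : 'rV[R]_n :=
  \row_k (if k == i then c * x 0 i - s * x 0 j
          else if k == j then s * x 0 i + c * x 0 j else x 0 k).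

Lemma rotvZ i j c s b x : rotv i j c s (b *: x) = b *: rotv i j c s x.
Proof.
apply/rowP => k; rewrite !mxE.
by case: ifP => _; last case: ifP => _ //; ring.
Qed.

Lemma dotv_rotv i j c s x y : i != j -> c ^+ 2 + s ^+ 2 = 1 ->
  dotv (rotv i j c s x) (rotv i j c s y) = dotv x y.
Proof.
move=> ij cs; rewrite /dotv.
rewrite (bigD1 i)//= (bigD1 j) 1?eq_sym//= [in RHS](bigD1 i)//= [in RHS](bigD1 j) 1?eq_sym//=.
rewrite !mxE !eqxx [j == i]eq_sym (negbTE ij) !addrA; congr (_ + _); last first.
  by apply: eq_bigr => k /andP[ki kj]; rewrite !mxE (negbTE ki) (negbTE kj).
transitivity ((c ^+ 2 + s ^+ 2) * (x 0 i * y 0 i + x 0 j * y 0 j)); first by ring.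
by rewrite cs mul1r.
Qed.

(** Counterpart of [rotv] on coordinate sequences, over which the iterated integrals run. *)
Definition rotg (i j : nat) (c s : R) g : nat -> R := fun k =>
  if k == i then c * g i - s * g j else if k == j then s * g i + c * g j else g k.

(* A plane rotation by an angle outside [pi Z] is a product of three shears. *)
Lemma rotg_shear (i j : nat) c s g : i != j -> c ^+ 2 + s ^+ 2 = 1 -> s != 0 ->
  rotg i j c s g = shear i j ((c - 1) / s) (shear j i s (shear i j ((c - 1) / s) g)).
Proof.
move=> ij cs s0; apply/funext => k.
rewrite /rotg /shear /upd !eqxx [j == i]eq_sym (negbTE ij).
have e : g j + s * (g i + (c - 1) / s * g j) = s * g i + c * g j by field.
rewrite e; case: (k == i) => //.
have s2 : s ^+ 2 = 1 - c ^+ 2 by rewrite -cs; ring.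
apply: (mulfI s0).
transitivity (s * c * g i - s ^+ 2 * g j); first by ring.
by rewrite s2; field.
Qed.

Lemma coords_int_rotg (i j : nat) c s (F : (nat -> R) -> R) :
  (i < n)%N -> (j < n)%N -> i != j -> c ^+ 2 + s ^+ 2 = 1 -> s != 0 ->
  nice [pred k | (k < n)%N] F -> coords_int n (F \o rotg i j c s) = coords_int n F.
Proof.
move=> ilt jlt ij cs s0 nF; have ji : j != i by rewrite eq_sym.
rewrite (_ : _ \o _ = ((F \o shear i j ((c - 1) / s)) \o shear j i s) \o shear i j ((c - 1) / s)).
  by rewrite !coords_int_shear//; repeat apply: shear_nice.
by apply/funext => g /=; rewrite rotg_shear.
Qed.

Definition cone h g : R :=
  let x := vec_of n g in
  if dotv x x <= 1 then h ((Num.sqrt (dotv x x))^-1 *: x) else 0.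

Lemma sphere_avgE h :
  sphere_avg h = iter_int n (cone h) / iter_int n (cone (fun=> 1)).
Proof. by []. Qed.

Lemma vec_of_rotg (i j : 'I_n) c s g :
  vec_of n (rotg i j c s g) = rotv i j c s (vec_of n g).
Proof. by apply/rowP => k; rewrite !mxE. Qed.

Lemma cone_rotg (i j : 'I_n) c s h : i != j -> c ^+ 2 + s ^+ 2 = 1 ->
  cone h \o rotg i j c s = cone (h \o rotv i j c s).
Proof.
move=> ij cs; apply/funext => g /=.
by rewrite /cone vec_of_rotg dotv_rotv// /= rotvZ.
Qed.

Lemma measurable_sqrtV d (T : measurableType d) (f : T -> R) :
  measurable_fun [set: T] f ->
  measurable_fun [set: T] (fun t => (Num.sqrt (f t))^-1).
Proof.
(* The inverse and the power [-1] agree on nonnegative reals, including the default value at [0]. *)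
move=> mf; rewrite (_ : (fun _ => _) = fun t => Num.sqrt (f t) `^ (-1)).
  apply: (measurableT_comp (measurable_powR _)).
  by apply: measurableT_comp mf; apply: continuous_measurable_fun; exact: sqrt_continuous.
by apply/funext => x; rewrite powR_inv1// sqrtr_ge0.
Qed.

(** The value is [1] except at [x = 0], where the inverse of [0] is [0] and the normalized vector
    vanishes. Hence bounds on [h] are asked on the ball instead of the sphere. *)
Lemma normalized_le1 x : dotv ((Num.sqrt (dotv x x))^-1 *: x) ((Num.sqrt (dotv x x))^-1 *: x) <= 1.
Proof.
rewrite dotvZl dotvC dotvZl mulrA -expr2 exprVn sqr_sqrtr ?dotv_ge0//.
have [->|d0] := eqVneq (dotv x x) 0; first by rewrite mulr0.
by rewrite mulVf.
Qed.

Lemma cone_nice h K : cmeasurable (fun g => h (vec_of n g)) ->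
  (forall y, dotv y y <= 1 -> 0 <= h y <= K) ->
  nice [pred k | (k < n)%N] (cone h).
Proof.
move=> mh hK; split.
- move=> d T f mf.
  have ms : measurable_fun [set: T] (fun t => dotv (vec_of n (f t)) (vec_of n (f t))).
    apply: measurable_sum => i; under eq_fun do rewrite !mxE.
    exact: measurable_funM.
  apply: measurable_fun_ifT => //; first exact: measurable_fun_ler.
  (* Absorbing the scaling factor into the coordinates gives another family of measurable
     coordinates, to which measurability of [h] applies. *)
  rewrite (_ : (fun _ => _) = fun t => h (vec_of n (fun k =>
      (Num.sqrt (dotv (vec_of n (f t)) (vec_of n (f t))))^-1 * f t k))).
    apply: mh => k; apply: measurable_funM => //.
    exact: measurable_sqrtV.
  by apply/funext => x; congr h; apply/rowP => k; rewrite !mxE.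
- move=> g; rewrite /cone; case: ifP => // _.
  by have /andP[] := hK _ (normalized_le1 (vec_of n g)).
- exists K => g; rewrite /cone.
  have /andP[h0 hk] := hK _ (normalized_le1 (vec_of n g)).
  by case: ifP => // _; exact: le_trans hk.
- exists 1 => g k /= kn; rewrite /cone; case: ifP => [g1 _|]; last by rewrite eqxx.
  have := le_trans (dotv_self_ge (vec_of n g) (Ordinal kn)) g1.
  by rewrite mxE /= -(real_normK (num_real (g k))) expr_le1.
Qed.

Lemma sphere_avg_rotv (i j : 'I_n) c s h K : i != j -> c ^+ 2 + s ^+ 2 = 1 -> s != 0 ->
  cmeasurable (fun g => h (vec_of n g)) ->
  (forall y, dotv y y <= 1 -> 0 <= h y <= K) ->
  sphere_avg (h \o rotv i j c s) = sphere_avg h.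
Proof.
move=> ij cs s0 mh hK; rewrite !sphere_avgE !iter_intE -cone_rotg// coords_int_rotg//.
exact: cone_nice hK.
Qed.

(** The cube [[0, 1/(n+1)]^n] lies in the unit ball: each squared coordinate is at most [1/(n+1)],
    and there are [n] of them. *)
Lemma ball_volume_gt0 : 0 < iter_int n (cone (fun=> 1)).
Proof.
have nc : nice [pred k | (k < n)%N] (cone (fun=> 1)).
  apply: (@cone_nice _ 1) => [d T f mf|y _]; first exact: measurable_cst.
  by rewrite ler01 lexx.
rewrite iter_intE.
have a0 : 0 < (n.+1%:R : R)^-1 by rewrite invr_gt0 ltr0n.
apply: lt_le_trans (coords_int_ge (ltW a0) nc _ (leqnn n) _).
- by rewrite exprn_gt0.
- move=> g ga; rewrite /cone ifT//.
  apply: (@le_trans _ _ (\sum_(i < n) (n.+1%:R : R)^-1)).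
    apply: ler_sum => i _; rewrite mxE.
    have /andP[g0 gn] := ga _ (ltn_ord i).
    apply: le_trans gn; rewrite ler_piMr//; apply: le_trans (_ : n.+1%:R^-1 <= 1).
    by have /andP[] := ga _ (ltn_ord i).
    by rewrite invf_le1 ?ler1n ?ltr0n.
  rewrite sumr_const card_ord -[_ *+ n]mulr_natl ler_pdivrMr ?ltr0n// mul1r ler_nat.
  exact: leqnSn.
- by move=> k /andP[nk kn]; move: (leq_ltn_trans nk kn); rewrite ltnn.
Qed.

Lemma sphere_avg1 : sphere_avg (fun _ : 'rV[R]_n => 1) = 1.
Proof. by rewrite sphere_avgE divff// gt_eqF// ball_volume_gt0. Qed.

End Rotation.

(** * Moments of a design *)

Section DesignMoments.
Variables (R : realType) (m tau : nat).
Local Notation n := m.+2.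
Variable C : seq 'rV[R]_n.
Hypothesis dC : spherical_design tau C.
Implicit Types (a x y : 'rV[R]_n).

(** The constant polynomial [1], obtained with exponent [0], has sphere average [1], whereas over an
    empty design the mean would be [0]. *)
Lemma design_neq0 : (size C)%:R != 0 :> R.
Proof.
have [_ [_ dp]] := dC.
have := dp (lin_mpoly 0 0 0) (lin_mpoly_deg _ _ (leq0n tau)).
have -> : sphere_avg (peval (lin_mpoly (0 : 'rV[R]_n) 0 0)) = 1.
  rewrite -(sphere_avg1 R n); congr sphere_avg; apply/funext => y.
  by rewrite peval_lin_mpoly expr0 addr0.
by apply: contra_eq_neq => ->; rewrite invr0 mul0r oner_neq0.
Qed.

Definition moment (k : nat) a : R := \sum_(y <- C) dotv a y ^+ k.

Lemma sphere_avg_moment k a M : (k <= tau)%N ->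
  sphere_avg (fun y => dotv a y ^+ k + M) = (size C)%:R^-1 * moment k a + M.
Proof.
move=> kt; have [_ [_ /(_ (lin_mpoly a k M) (lin_mpoly_deg _ _ kt))]] := dC.
have -> : peval (lin_mpoly a k M) = fun y => dotv a y ^+ k + M.
  by apply/funext => y; rewrite peval_lin_mpoly.
move=> ->.
rewrite big_split /= big_const_seq count_predT iter_addr addr0 -[M *+ _]mulr_natl.
by rewrite mulrDr mulKf ?design_neq0.
Qed.

Lemma dotv_bound a y : dotv y y <= 1 -> `|dotv a y| <= \sum_(i < n) `|a 0 i|.
Proof.
move=> y1; apply: le_trans (ler_norm_sum _ _ _) _; apply: ler_sum => i _.
rewrite normrM ler_piMr// -(@expr_le1 _ 2)// real_normK ?num_real//.
exact: le_trans (dotv_self_ge _ _) y1.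
Qed.

(** The design property turns moments into sphere averages, which are rotation invariant; rotating
    both arguments of [dotv] leaves it unchanged. The added constant [M] cancels at the end. *)
Lemma moment_rotv k a (i j : 'I_n) c s : (k <= tau)%N ->
  i != j -> c ^+ 2 + s ^+ 2 = 1 -> s != 0 ->
  moment k (rotv i j c s a) = moment k a.
Proof.
move=> kt ij cs s0; set b := rotv i j c s a.
pose M := (\sum_(l < n) `|b 0 l|) ^+ k.
have hM y : dotv y y <= 1 -> 0 <= dotv b y ^+ k + M <= M + M.
  move=> /(dotv_bound b) /(lerXn2r k) bM.
  have {}bM : `|dotv b y ^+ k| <= M.
    by rewrite normrX; apply: bM; rewrite nnegrE// sumr_ge0.
  by move: bM; rewrite ler_norml; lra.
have := sphere_avg_rotv ij cs s0 _ hM.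
have -> : (fun y => dotv b y ^+ k + M) \o rotv i j c s = fun y => dotv a y ^+ k + M.
  by apply/funext => y /=; rewrite dotv_rotv.
rewrite !sphere_avg_moment// => H; apply/esym/(mulfI (invr_neq0 design_neq0))/(addIr M).
apply: H => d T f mf; apply: measurable_funD => //; apply: measurable_funX.
apply: measurable_sum => i'; under eq_fun do rewrite !mxE.
exact: measurable_funM.
Qed.

Let e0 : 'rV[R]_n := delta_mx 0 0.

Lemma momentZ k r a : moment k (r *: a) = r ^+ k * moment k a.
Proof.
by rewrite /moment mulr_sumr; apply: eq_bigr => y _; rewrite dotvZl exprMn.
Qed.

Lemma moment_radial k a : (k <= tau)%N ->
  moment k a = Num.sqrt (dotv a a) ^+ k * moment k e0.
Proof.
move=> kt.
have rot2 (j : 'I_n) c s b : j != 0 -> c ^+ 2 + s ^+ 2 = 1 ->  s != 0 ->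
    dotv (rotv 0 j c s b) (rotv 0 j c s b) = dotv b b /\
    moment k (rotv 0 j c s b) = moment k b.
  by rewrite eq_sym => j0 cs s0; rewrite dotv_rotv// moment_rotv.
have base r : moment k (r *: e0) = Num.sqrt (dotv (r *: e0) (r *: e0)) ^+ k * moment k e0.
  have -> : dotv (r *: e0) (r *: e0) = r ^+ 2.
    by rewrite dotvZl dotv_delta !mxE eqxx mulr1 expr2.
  rewrite sqrtr_sqr -momentZ; have [r0|r0] := leP 0 r; first by rewrite ger0_norm.
  rewrite ltr0_norm//.
  (* For negative [r], two quarter turns reverse the vector; a half turn itself has [s = 0] and is
     excluded. *)
  have i1 : (lift ord0 ord0 : 'I_n) != 0 by [].
  have H : (0 : R) ^+ 2 + 1 ^+ 2 = 1 by rewrite expr0n expr1n add0r.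
  rewrite -(rot2 _ _ _ (r *: e0) i1 H (oner_neq0 _)).2.
  rewrite -(rot2 _ _ _ (rotv _ _ _ _ (r *: e0)) i1 H (oner_neq0 _)).2.
  congr moment; apply/rowP => l; rewrite !mxE !eqxx !(negbTE i1) /=.
  case: (l == 0) => /=; first by ring.
  by case: (l == lift ord0 ord0) => /=; ring.
(* Rotations in the planes (0, l) clear the coordinates of [a] one by one. *)
suff : forall l a, (forall j : 'I_n, (l < j)%N -> a 0 j = 0) ->
    moment k a = Num.sqrt (dotv a a) ^+ k * moment k e0.
  by move=> /(_ n a); apply=> j nj; have := ltn_trans nj (ltn_ord j); rewrite ltnn.
elim=> [|l IH] {}a a0.
  suff -> : a = a 0 0 *: e0 by exact: base.
  apply/rowP => j; rewrite !mxE /=.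
  case: (eqVneq j 0) => [->|j0]; first by rewrite mulr1.
  by rewrite mulr0 a0// lt0n.
have [ln|nl] := ltnP l.+1 n; last first.
  by apply: IH => j lj; have := leq_trans (ltn_ord j) nl; rewrite ltnS leqNgt lj.
pose j : 'I_n := Ordinal ln.
have [aj|aj] := eqVneq (a 0 j) 0.
  apply: IH => i; rewrite leq_eqVlt => /orP[/eqP li|]; last exact: a0.
  by rewrite (_ : i = j)//; exact: val_inj.
pose r := Num.sqrt (a 0 0 ^+ 2 + a 0 j ^+ 2).
have r2 : r ^+ 2 = a 0 0 ^+ 2 + a 0 j ^+ 2 by rewrite sqr_sqrtr// addr_ge0 ?sqr_ge0.
have r0 : r != 0.
  apply: contra_neq aj => r0; move: r2; rewrite r0 expr0n /=.
  have := sqr_ge0 (a 0 0); have := sqr_ge0 (a 0 j) => h1 h2 h.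
  by apply/eqP; rewrite -sqrf_eq0; apply/eqP; lra.
(* With this cosine and sine the new coordinate [j] is [s * a 0 0 + c * a 0 j = 0]. *)
have cs : (a 0 0 / r) ^+ 2 + (- (a 0 j) / r) ^+ 2 = 1.
  by rewrite !exprMn sqrrN -mulrDl -r2 -exprMn divff// expr1n.
have s0 : - (a 0 j) / r != 0 by rewrite mulf_neq0 ?oppr_eq0 ?invr_neq0.
have j0 : j != 0 by [].
have [<- <-] := rot2 j _ _ a j0 cs s0.
apply: IH => i li; rewrite !mxE.
have i0 : i == 0 = false by apply/negbTE; rewrite -lt0n (leq_ltn_trans _ li).
rewrite i0; case: eqP => [_|ij]; first by field.
apply: a0; rewrite ltn_neqAle li andbT; apply/eqP => li'; apply: ij.
by apply: val_inj.
Qed.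

Lemma moment_unit k a : (k <= tau)%N -> dotv a a = 1 -> moment k a = moment k e0.
Proof. by move=> kt a1; rewrite moment_radial// a1 sqrtr1 expr1n mul1r. Qed.

Lemma dotv_e0 : dotv e0 e0 = 1.
Proof. by rewrite dotv_delta mxE eqxx. Qed.

(** Opposite unit vectors have equal moments, so an odd moment equals its own negative. *)
Lemma moment_odd k : (k <= tau)%N -> odd k -> moment k e0 = 0.
Proof.
move=> kt ok; have : moment k (-1 *: e0) = moment k e0.
  by apply: moment_unit => //; rewrite dotvZl dotvC dotvZl dotv_e0; ring.
by rewrite momentZ -signr_odd ok; lra.
Qed.

Lemma moment0 : moment 0 e0 = (size C)%:R.
Proof.
rewrite /moment; under eq_bigr do rewrite expr0.
by rewrite big_const_seq count_predT iter_addr addr0.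
Qed.

(** * Recursion for the even moments *)

Lemma poly_ext (p q : {poly R}) : (forall t, p.[t] = q.[t]) -> p = q.
Proof.
move=> pq; apply/eqP; rewrite -subr_eq0; apply: contraT => pq0.
(* The natural numbers below [size (p - q)] are distinct roots, one more than a nonzero polynomial
   of this size can have. *)
have /= := max_poly_roots (rs := [seq k%:R | k <- iota 0 (size (p - q))]) pq0.
rewrite size_map size_iota ltnn => -> //.
  by apply/allP => t _; rewrite /root !hornerE pq subrr.
by rewrite map_inj_uniq ?iota_uniq//; exact: mulrIn (oner_neq0 R).
Qed.

Lemma coef2_binomial (a b : R) k :
  ((a%:P + b%:P * 'X) ^+ k.+2)`_2 = (a ^+ k * b ^+ 2) *+ 'C(k.+2, 2).
Proof.
rewrite exprDn coef_sum (bigD1 (inord 2)) //= big1 => [|i i2]; last first.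
  rewrite coefMn exprMn mulrA -!polyC_exp -polyCM coefCM coefXn.
  case: eqP => [e2|]; last by rewrite mulr0 mul0rn.
  by case/eqP: i2; apply: val_inj; rewrite /= inordK.
rewrite coefMn exprMn mulrA -!polyC_exp -polyCM coefCM coefXn inordK// eqxx.
by rewrite mulr1 addr0 subSS subn1.
Qed.

Lemma coef2_one_plus_sqr k :
  (('X ^+ 2 + 1 : {poly R}) ^+ k)`_0 = 1 /\ (('X ^+ 2 + 1 : {poly R}) ^+ k)`_2 = k%:R.
Proof.
elim: k => [|k [c0 c2]]; first by rewrite expr0 !coefC.
by rewrite exprSr mulrDr mulr1 !coefD !coefMXn /= c0 c2 add0r -natr1 addrC.
Qed.

(* Compare the coefficients of [t ^+ 2] in the moment of [e_0 + t e_i], which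
   is [(1 + t ^+ 2) ^+ l] times that of [e_0]. *)
Lemma moment_mixed l (i : 'I_n) : (l.+1.*2 <= tau)%N -> i != 0 ->
  (\sum_(y <- C) y 0 0 ^+ l.*2 * y 0 i ^+ 2) *+ 'C(l.+1.*2, 2) =
  moment l.+1.*2 e0 *+ l.+1.
Proof.
move=> lt i0.
pose P : {poly R} := \sum_(y <- C) ((y 0 0)%:P + (y 0 i)%:P * 'X) ^+ l.+1.*2.
pose Q : {poly R} := (moment l.+1.*2 e0)%:P * ('X ^+ 2 + 1) ^+ l.+1.
have PQ : P = Q.
  apply: poly_ext => t; rewrite /P horner_sum /Q.
  rewrite !hornerE.
  transitivity (moment l.+1.*2 (e0 + t *: delta_mx 0 i)).
    apply: eq_bigr => y _; rewrite !hornerE dotvDl dotvZl !dotv_delta.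
    by rewrite [_ * t]mulrC.
  rewrite moment_radial// mulrC; congr (_ * _).
  rewrite dotvDl dotvZl !dotv_delta !mxE !eqxx /= [0 == i]eq_sym (negbTE i0) /=.
  rewrite -mul2n exprM sqr_sqrtr; last first.
    by rewrite mulr0 add0r addr0 mulr1 addr_ge0// -expr2 sqr_ge0.
  by congr (_ ^+ _); ring.
have := congr1 (fun p : {poly R} => p`_2) PQ.
rewrite /P /Q coefCM coef_sum (coef2_one_plus_sqr _).2 mulr_natr => <-.
by rewrite -sumrMnl; apply: eq_bigr => y _; rewrite doubleS coef2_binomial.
Qed.

(** Sum the mixed moments over the [m.+1] indices [i != 0]: on the sphere the squares of these
    coordinates add up to [1 - y 0 0 ^+ 2]. The binomial coefficient is [l.*2.+1 * l.+1], and [l.+1]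
    cancels. *)
Lemma moment_rec l : (l.+1.*2 <= tau)%N ->
  (l.*2.+1)%:R * (moment l.*2 e0 - moment l.+1.*2 e0) = m.+1%:R * moment l.+1.*2 e0.
Proof.
move=> lt.
have bin : ('C(l.+1.*2, 2) = l.*2.+1 * l.+1)%N.
  by rewrite bin2 -mul2n -mulnA mul2n doubleK mul2n doubleS mulnC.
have unit_sum y : y \in C -> \sum_(i < n | i != 0) y 0 i ^+ 2 = 1 - y 0 0 ^+ 2.
  move=> yC; have [_ [/(_ _ yC) <- _]] := dC.
  rewrite /dotv [in RHS](bigD1 0)//= -expr2 addrAC subrr add0r.
  by apply: eq_bigr => i _; rewrite expr2.
have : \sum_(i < n | i != 0) (\sum_(y <- C) y 0 0 ^+ l.*2 * y 0 i ^+ 2) *+ 'C(l.+1.*2, 2) =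
    \sum_(i < n | i != 0) moment l.+1.*2 e0 *+ l.+1.
  by apply: eq_bigr => i i0; rewrite moment_mixed.
rewrite sumr_const (eq_card (B := predC1 0)) ?cardC1 ?card_ord// sumrMnl exchange_big /=.
under eq_big_seq => y yC.
  rewrite -mulr_sumr (unit_sum _ yC) mulrBr mulr1 -exprD addn2 -doubleS.
  over.
rewrite sumrB bin !mulrnA => H.
have mE k : moment k e0 = \sum_(y <- C) y 0 0 ^+ k.
  by apply: eq_bigr => y _; rewrite dotv_delta.
rewrite -!mE in H.
have l0 : (l.+1%:R : R) != 0 by rewrite pnatr_eq0.
by apply: (mulIf l0); rewrite ![_%:R * _]mulrC !mulr_natr H -!mulrnA mulnC.
Qed.

End DesignMoments.

(** * The linear programming bound in dimension 48 *)

(* Numerals above 5000 are parsed as [Nat.of_num_uint], whose unary normal form is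
   far too large to compute: their image in a ring is read off the digits. *)
Fixpoint decimal_val (R : comNzRingType) (d : Decimal.uint) (acc : R) : R :=
  match d with
  | Decimal.Nil => acc
  | Decimal.D0 d => decimal_val d (10 * acc)
  | Decimal.D1 d => decimal_val d (1 + 10 * acc)
  | Decimal.D2 d => decimal_val d (2 + 10 * acc)
  | Decimal.D3 d => decimal_val d (3 + 10 * acc)
  | Decimal.D4 d => decimal_val d (4 + 10 * acc)
  | Decimal.D5 d => decimal_val d (5 + 10 * acc)
  | Decimal.D6 d => decimal_val d (6 + 10 * acc)
  | Decimal.D7 d => decimal_val d (7 + 10 * acc)
  | Decimal.D8 d => decimal_val d (8 + 10 * acc)
  | Decimal.D9 d => decimal_val d (9 + 10 * acc)
  end.

Lemma of_uint_accE (R : comNzRingType) d n :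
  (Nat.of_uint_acc d n)%:R = decimal_val d n%:R :> R.
Proof.
pose ten := Nat.of_num_uint (Number.UIntDecimal (Decimal.D1 (Decimal.D0 Decimal.Nil))).
have E k : Nat.tail_mul ten k = (10 * k)%N.
  have H1 a b : Nat.tail_add a b = (a + b)%N by elim: a b => //= a IH b; rewrite IH addnS.
  have H2 a b c : Nat.tail_addmul a b c = (a + b * c)%N.
    by elim: b a => [|b IH] a /=; rewrite ?addn0// IH H1 mulSn addnCA addnA.
  by rewrite /Nat.tail_mul H2.
elim: d n => [|d IH|d IH|d IH|d IH|d IH|d IH|d IH|d IH|d IH|d IH] n; first by [].
all: by rewrite [LHS]IH [in LHS]E /=; congr decimal_val; ring.
Qed.

Lemma natr_num_uint (R : comNzRingType) d :
  (Nat.of_num_uint (Number.UIntDecimal d))%:R = decimal_val d 0 :> R.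
Proof. exact: of_uint_accE. Qed.

Section Dimension48.
Variables (R : realType) (C : seq 'rV[R]_48).
Hypothesis dC : spherical_design 11 C.
Hypothesis C_inner : forall x y, x \in C -> y \in C -> x != y ->
  -1 <= dotv x y < 1 /\ ~ in_F' (dotv x y).

(** Missing coefficients default to [0], so shorter lists are allowed; the degree never exceeds the
    design strength [11]. *)
Definition coef_eval (c : seq R) (t : R) : R := \sum_(k < 12) c`_k * t ^+ k.

(* The mean of [y |-> coef_eval c (dotv x y)] over S^47, in Horner form: the even
   moments of a coordinate are 1/48, 3/(48*50), 3*5/(48*50*52), ... *)
Definition coef_mean (c : seq R) : R :=
  c`_0 + 1 / 48 * (c`_2 + 3 / 50 * (c`_4 + 5 / 52 * (c`_6 +
    7 / 54 * (c`_8 + 9 / 56 * c`_10)))).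

(** Exchanging the sums leaves the moments in the unit direction [x], which are those of the first
    axis: the odd ones vanish and the even ones follow from the recursion. *)
Lemma design_coef_sum (c : seq R) x : x \in C ->
  \sum_(y <- C) coef_eval c (dotv x y) = (size C)%:R * coef_mean c.
Proof.
move=> xC; have x1 : dotv x x = 1 by have [_ [/(_ _ xC)]] := dC.
rewrite exchange_big /=.
under eq_bigr => k _.
  rewrite -mulr_sumr -[X in _ * X]/(moment C k x) (moment_unit dC) //; last by rewrite -ltnS.
  over.
have m0 := moment0 C.
have m1 := moment_odd dC (k := 1) isT isT.
have m3 := moment_odd dC (k := 3) isT isT.
have m5 := moment_odd dC (k := 5) isT isT.
have m7 := moment_odd dC (k := 7) isT isT.
have m9 := moment_odd dC (k := 9) isT isT.
have m11 := moment_odd dC (k := 11) isT isT.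
have m2 := moment_rec dC (l := 0) isT.
have m4 := moment_rec dC (l := 1) isT.
have m6 := moment_rec dC (l := 2) isT.
have m8 := moment_rec dC (l := 3) isT.
have m10 := moment_rec dC (l := 4) isT.
rewrite !big_ord_recl big_ord0 /= /bump /= !add1n m1 m3 m5 m7 m9 m11 -m0 !mulr0.
move: m2 m4 m6 m8 m10; rewrite !(doubleS, double0).
move: (moment C 0 _) (moment C 2 _) (moment C 4 _) (moment C 6 _) (moment C 8 _) (moment C 10 _).
move=> u0 u2 u4 u6 u8 u10 m2 m4 m6 m8 m10.
have e2 : u2 = u0 / 48 by lra.
have e4 : u4 = 3 / 50 * u2 by lra.
have e6 : u6 = 5 / 52 * u4 by lra.
have e8 : u8 = 7 / 54 * u6 by lra.
have e10 : u10 = 9 / 56 * u8 by lra.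
by rewrite /coef_mean e10 e8 e6 e4 e2; ring.
Qed.

(** The polynomial [f] expanded, constant term first; its factor [t + 1] makes the coefficients
    equal in consecutive pairs. *)
Definition lp_coef : seq R :=
  let a := 1 / 36 / 36 / 36 in let b := - (85 * a) in
  [:: 0; 0; a; a; b; b; 7 / 144; 7 / 144; - (5 / 12); - (5 / 12); 1; 1].

Lemma lp_coefE t : coef_eval lp_coef t =
  (t + 1) * ((t ^+ 2 - 1 / 4) * (t ^+ 2 - 1 / 9)) * ((t ^+ 2 - 1 / 36) * t) ^+ 2.
Proof. by rewrite /coef_eval !big_ord_recl big_ord0 /=; by field. Qed.

Definition inner_roots : seq R :=
  [:: -1; 1 / 2; - (1 / 2); 1 / 3; - (1 / 3); 1 / 6; - (1 / 6); 0].

Lemma lp_root t : coef_eval lp_coef t = 0 -> t \in inner_roots.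
Proof.
have -> : coef_eval lp_coef t = (t + 1) * ((t - 1 / 2) * (t + 1 / 2)) *
    ((t - 1 / 3) * (t + 1 / 3)) * ((t - 1 / 6) * (t + 1 / 6) * t) ^+ 2.
  by rewrite lp_coefE; field.
move=> /eqP; rewrite !inE !(mulf_eq0, expf_eq0, subr_eq0, addr_eq0) /= -!orbA.
by do 10![case/orP=> [->|]; first by rewrite ?orbT]; move=> ->; rewrite !orbT.
Qed.

(** Only [(t^2 - 1/4) (t^2 - 1/9)] can be negative, and it is so exactly for [1/9 < t^2 < 1/4], that
    is on the forbidden intervals. *)
Lemma lp_ge0 t : -1 <= t -> ~ in_F' t -> 0 <= coef_eval lp_coef t.
Proof.
move=> t1 tF; rewrite lp_coefE mulr_ge0 ?sqr_ge0// mulr_ge0//; first by lra.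
have [h1|h1] := leP (t ^+ 2) (1 / 9); first by rewrite mulr_le0//; lra.
have [h2|h2] := leP (1 / 4) (t ^+ 2); first by rewrite mulr_ge0//; lra.
exfalso; apply: tF; rewrite /in_F'; have [t0|t0] := leP 0 t.
  by right; apply/andP; split; nra.
by left; apply/andP; split; nra.
Qed.

(** The bound is the ratio of [f(1)] to the mean of [f]. It is assembled from small numerals, which
    [field] can compute with. *)
Lemma lp_mean :
  coef_eval lp_coef 1 = (52 * 1000 * 1000 + 416 * 1000) * coef_mean lp_coef /\
  0 < coef_mean lp_coef.
Proof.
by rewrite lp_coefE /coef_mean /=; split; [field | lra].
Qed.

Local Notation card_bound := (52 * 1000 * 1000 + 416 * 1000 : R).

Let design_norm1 x : x \in C -> dotv x x = 1.
Proof. by have [_ [/(_ x)]] := dC. Qed.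

(** The diagonal term [y = x] contributes [f(1)], which is the bound times the mean. *)
Lemma lp_sum x : x \in C ->
  \sum_(y <- C | y != x) coef_eval lp_coef (dotv x y) =
  ((size C)%:R - card_bound) * coef_mean lp_coef.
Proof.
move=> xC; have [uC _] := dC.
have := design_coef_sum lp_coef xC.
rewrite (bigD1_seq x)//= design_norm1// lp_mean.1 mulrBl => <-.
by rewrite addrAC subrr add0r.
Qed.

Lemma lp_term_ge0 x y : x \in C -> y \in C -> y != x ->
  0 <= coef_eval lp_coef (dotv x y).
Proof.
by move=> xC yC; rewrite eq_sym => /(C_inner xC yC)[/andP[? _]]; exact: lp_ge0.
Qed.

Lemma design_bound : card_bound <= (size C)%:R.
Proof.
have [x xC] : exists x, x \in C.
  case: C dC => [d0|x s _]; last by exists x; rewrite mem_head.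
  by have := design_neq0 d0; rewrite eqxx.
rewrite -subr_ge0 -(pmulr_lge0 _ lp_mean.2) -(lp_sum xC) big_seq_cond.
by apply: sumr_ge0 => y /andP[yC yx]; exact: lp_term_ge0.
Qed.

(** At equality the nonnegative off-diagonal terms add up to [0], so each of them vanishes. *)
Lemma inner_in_roots x y : (size C)%:R = card_bound ->
  x \in C -> y \in C -> y != x -> dotv x y \in inner_roots.
Proof.
move=> sC xC yC yx; apply: lp_root; apply/eqP; rewrite eq_le lp_term_ge0// andbT.
have [uC _] := dC; have := lp_sum xC; rewrite sC subrr mul0r => <-.
rewrite (big_rem y yC) /= yx lerDl big_seq_cond.
by apply: sumr_ge0 => z /andP[/mem_rem zC zx]; exact: lp_term_ge0.
Qed.

Lemma A_count_out x t : (size C)%:R = card_bound -> x \in C -> t < 1 ->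
  t \notin inner_roots -> A_count C t x = 0%N.
Proof.
move=> sC xC t1 tr; apply/eqP; rewrite -leqn0 leqNgt -has_count -all_predC.
apply/allP => y yC /=; have [->|yx] := eqVneq y x.
  by rewrite design_norm1// gt_eqF.
by apply: contraNneq tr => <-; exact: inner_in_roots.
Qed.

(* [c] lists the coefficients of the Lagrange polynomial that is [1] at [t] and
   [0] at the other roots. *)
Lemma A_count_lagrange (c : seq R) x t k : (size C)%:R = card_bound ->
  x \in C -> t < 1 ->
  (forall s, s \in inner_roots -> coef_eval c s = (s == t)%:R) ->
  k%:R = card_bound * coef_mean c - coef_eval c 1 -> A_count C t x = k.
Proof.
move=> sC xC t1 ct kE; have [uC _] := dC.
apply/eqP; rewrite -(eqr_nat R) kE -sC -(design_coef_sum c xC).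
(* The subtracted value at [1] is the diagonal term; since [t < 1], [x] itself is not counted
   either. *)
rewrite (bigD1_seq x)//= design_norm1// addrAC subrr add0r.
rewrite /A_count -sum1_count big_mkcond natr_sum (bigD1_seq x)//= design_norm1//.
rewrite [1 == t]gt_eqF//= add0r big_seq_cond [X in _ == X]big_seq_cond.
apply/eqP/eq_bigr => y /andP[yC yx]; rewrite ct; last exact: inner_in_roots.
by case: (_ == t).
Qed.

End Dimension48.

(** * The distance distribution in the equality case *)

Ltac lagrange_roots :=
  let s := fresh in let e := fresh in
  move=> s; clear -s; rewrite !inE /coef_eval !big_ord_recl big_ord0 /=;
  do ?[case/orP]; move=> /eqP -> {s};
  (first [rewrite eqxx | case: eqP => [e|_]; [exfalso; lra|]]); rewrite /=; by field.

Ltac lagrange_value :=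
  rewrite /coef_mean /coef_eval !big_ord_recl big_ord0 /=; by field.

Lemma A_count_distribution (R : realType) (C : seq 'rV[R]_48) x t :
  spherical_design 11 C ->
  (forall x y, x \in C -> y \in C -> x != y ->
     -1 <= dotv x y < 1 /\ ~ in_F' (dotv x y)) ->
  size C = 52416000%N -> x \in C -> -1 <= t < 1 ->
  A_count C t x = theorem7_distribution t.
Proof.
move=> dC C_inner sC xC /andP[_ t1].
have {}sC : (size C)%:R = 52 * 1000 * 1000 + 416 * 1000 :> R.
  by rewrite sC; apply: etrans (natr_num_uint _ _) _ => /=; ring.
have lag c k := A_count_lagrange (c := c) (k := k) dC C_inner sC xC t1.
rewrite /theorem7_distribution.
have [tE|t0] := eqVneq t (-1).
  (* The other seven roots are symmetric about [0], so this Lagrange polynomial is odd. *)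
  apply: (lag [:: 0; 1 / 840; 0; - (7 / 120); 0; 3 / 5; 0; - (54 / 35)]).
    rewrite tE; lagrange_roots.
  lagrange_value.
have [tE|t1'] := eqVneq t (1 / 2).
  apply: (lag [:: 0; 1 / 15; 1 / 5; - (43 / 15); - 9; 78 / 5; 324 / 5; 216 / 5]).
    rewrite tE; lagrange_roots.
  (* From here on the counts are large numerals and are read off their digits. *)
  apply: etrans (natr_num_uint _ _) _; lagrange_value.
have [tE|t2] := eqVneq t (- (1 / 2)).
  apply: (lag [:: 0; - (1 / 5); 1 / 5; 47 / 5; - 9; - (414 / 5); 324 / 5; 648 / 5]).
    rewrite tE; lagrange_roots.
  apply: etrans (natr_num_uint _ _) _; lagrange_value.
have [tE|t3] := eqVneq t (1 / 3).
  apply: (lag [:: 0; - (27 / 40); - (27 / 10); 999 / 40; 108;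
               - (81 / 5); - (1944 / 5); - (1458 / 5)]).
    rewrite tE; lagrange_roots.
  apply: etrans (natr_num_uint _ _) _; lagrange_value.
have [tE|t4] := eqVneq t (- (1 / 3)).
  apply: (lag [:: 0; 27 / 20; - (27 / 10); - (1161 / 20); 108; 1782 / 5;
               - (1944 / 5); - (2916 / 5)]).
    rewrite tE; lagrange_roots.
  apply: etrans (natr_num_uint _ _) _; lagrange_value.
have [tE|t5] := eqVneq t (1 / 6).
  (* The product [8 * 729] keeps both numerals below the threshold of [5000]. *)
  apply: (lag [:: 0; 27 / 7; 27; - 27; - 351; - 162; 972; 8 * 729 / 7]).
    rewrite tE; lagrange_roots.
  apply: etrans (natr_num_uint _ _) _; lagrange_value.
have [tE|t6] := eqVneq t (- (1 / 6)).
  apply: (lag [:: 0; - (27 / 5); 27; 513 / 5; - 351; - (3078 / 5); 972; 8 * 729 / 5]).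
    rewrite tE; lagrange_roots.
  apply: etrans (natr_num_uint _ _) _; lagrange_value.
have [tE|t7] := eqVneq t 0.
  (* This is [(1 + t) (1 - 4 t^2) (1 - 9 t^2) (1 - 36 t^2)]. *)
  apply: (lag [:: 1; 1; - 49; - 49; 504; 504; - 1296; - 1296]).
    rewrite tE; lagrange_roots.
  apply: etrans (natr_num_uint _ _) _; lagrange_value.
apply: (A_count_out dC C_inner sC xC t1).
by rewrite !inE !negb_or t0 t1' t2 t3 t4 t5 t6 t7.
Qed.

Theorem theorem7 (R : realType) (C : seq 'rV[R]_48) :
  spherical_design 11 C ->
  (forall x y, x \in C -> y \in C -> x != y ->
     -1 <= dotv x y < 1 /\ ~ in_F' (dotv x y)) ->
  (52416000 <= size C)%N /\
  (size C = 52416000%N ->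
     distance_invariant C /\
     forall x t, x \in C -> -1 <= t < 1 ->
       A_count C t x = theorem7_distribution t).
Proof.
move=> dC C_inner; split.
  rewrite -(ler_nat R); apply: le_trans _ (design_bound dC C_inner).
  rewrite le_eqVlt; apply/orP; left; apply/eqP.
  by apply: etrans (natr_num_uint _ _) _ => /=; ring.
move=> sC; split; last by move=> x t; exact: A_count_distribution.
move=> t t1 x y xC yC.
exact: etrans (A_count_distribution dC C_inner sC xC t1)
              (esym (A_count_distribution dC C_inner sC yC t1)).
Qed.
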